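(* Let $(\mathcal{A}^V,X_1,\Phi_1)$ and $(\mathcal{B}^W,X_2,\Phi_2)$ be two symbolic dynamical systems with networks $(V,\to_1)$ and $(W,\to_2)$ respectively, and let $d_1$ and $d_2$ be dimensionally compatible Lipschitz metrics on $X_1$ and $X_2$ respectively. (a) If there is a factor mapping $(X_1,\Phi_1)\to(X_2,\Phi_2)$ which is $(d_1,d_2)$-Hölder, then $\dim(V,\to_1)\ge\dim(W,\to_2)$. (b) If $(X_1,\Phi_1)$ and $(X_2,\Phi_2)$ are conjugate via a $(d_1,d_2)$-bi-Hölder homeomorphism, then $\dim(V,\to_1)=\dim(W,\to_2)$.
   Context: Let $\mathcal{A}$ be a finite set with the discrete topology and $V$ a countably infinite set; $\mathcal{A}^{V}$ has the product topology (likewise $\mathcal{B}$, $W$). A pattern space is a closed perfect subset $X\subseteq\mathcal{A}^{V}$. A symbolic dynamical system is a triple $(\mathcal{A}^{V},X,\Phi)$ where $X\subseteq\mathcal{A}^V$ is a pattern space and $\Phi:\mathcal{A}^{V}\to\mathcal{A}^{V}$ is continuous with $\Phi(X)\subseteq X$. Network: for each $w\in V$, $\Phi_{\mathrm{in}}(w)$ is the (finite) set of $v\in V$ on which $\Phi(\cdot)_w$ depends nontrivially (there are $a,a'\in\mathcal{A}^V$ differing only at $v$ with $\Phi(a)_w\ne\Phi(a')_w$). The network of $\Phi$ is the digraph on $V$ with $v\to w$ iff $v\in\Phi_{\mathrm{in}}(w)$. Connectivity dimension: for $U\subseteq V$, $B(U,1):=U\cup\{v\in V:\exists u\in U,\ v\to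 u\}$, $B(U,n+1):=B(B(U,n),1)$, $B(v,r):=B(\{v\},r)$. Put $\underline{\dim}_v(V,\to):=\liminf_{r\to\infty}\frac{\log|B(v,r)|}{\log r}$, $\overline{\dim}_v(V,\to):=\limsup_{r\to\infty}\frac{\log|B(v,r)|}{\log r}$, $\underline{\dim}(V,\to):=\inf_{v\in V}\underline{\dim}_v(V,\to)$, $\overline{\dim}(V,\to):=\sup_{v\in V}\overline{\dim}_v(V,\to)$. If $\underline{\dim}(V,\to)=\overline{\dim}(V,\to)$, the digraph is called dimensionally homogeneous and the common value is $\dim(V,\to)$. Metric dimension: for a metric space $(X,d)$ let $N_\epsilon(X)$ be the minimal cardinality of a cover of $X$ by open sets of diameter at most $\epsilon$; $\underline{\dim}(X,d):=\liminf_{\epsilon\to0}\frac{\log\log N_\epsilon(X)}{\log(-\log\epsilon)}$, $\overline{\dim}(X,d):=\limsup_{\epsilon\to0}\frac{\log\log N_\epsilon(X)}{\log(-\log\epsilon)}$, and $\dim(X,d)$ is their common value if they agree. A metric $d$ on $X$ is always assumed compatible with the topology of $X$. It is a Lipschitz metric for $\Phi$ if there is $\lambda>0$ with $d(\Phi(x),\Phi(x'))\le\lambda\, d(x,x')$ for all $x,x'\in X$. It is dimensionally compatible if the network $(V,\to)$ is dimensionally homogeneous, $\dim(X,d)$ exists, and $\dim(X,d)=\dim(V,\to)$. In the claim, $d_i$ is a Lipschitz metric for $\Phi_i$ and dimensionally compatible with the network of $\Phi_i$. A continuous map $\Gamma:(X,d)\to(X',d')$ is $(d,d')$-Hölder if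 there are $\eta,\lambda\in(0,\infty)$ with $d'(\Gamma(x),\Gamma(y))\le\lambda\, d(x,y)^\eta$ for all $x,y\in X$; a homeomorphism $\Gamma$ is $(d,d')$-bi-Hölder if $\Gamma$ and $\Gamma^{-1}$ are both Hölder (possibly with different constants). A factor mapping $(X_1,\Phi_1)\to(X_2,\Phi_2)$ is a continuous surjection $\Gamma:X_1\to X_2$ with $\Gamma\circ\Phi_1=\Phi_2\circ\Gamma$; a conjugacy is a homeomorphism with this intertwining property. *)

(* Defs.v *)
From HB Require Import structures.
From mathcomp Require Import all_boot all_order all_algebra.
From mathcomp Require Import all_classical all_reals all_analysis.
Set Implicit Arguments.
Unset Strict Implicit.
Unset Printing Implicit Defensive.
Import Order.TTheory GRing.Theory Num.Theory.
Import numFieldNormedType.Exports.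
Local Open Scope classical_set_scope.
Local Open Scope ring_scope.

Notation config V A := ({ptws V -> discrete_topology A}).

Section SymbolicSystems.
Variables (A : finType) (V : choiceType).
Implicit Types (X : set (config V A)) (Phi : config V A -> config V A).

Definition pattern_space X := perfect_set X.

Definition symbolic_system X Phi :=
  [/\ pattern_space X, continuous Phi & Phi @` X `<=` X].

Definition phi_in Phi (w : V) : set V :=
  [set v | exists a a' : config V A,
    (forall u, u != v -> a u = a' u) /\ Phi a w <> Phi a' w].

(* [network Phi v w] is the edge v -> w *)
Definition network Phi : V -> V -> Prop := fun v w => phi_in Phi w v.

End SymbolicSystems.

(* Cardinalities, logarithms and dimensions below are extended reals:
   [counting] is +oo on infinite sets, [lne +oo = +oo], [lne 0 = -oo].  The
   quotients take junk values only where the denominator is not positive, which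
   the limits do not see. *)
Section ConnectivityDimension.
Variables (R : realType) (V : choiceType) (E : V -> V -> Prop).

Definition nbhd1 (U : set V) : set V :=
  U `|` [set v | exists2 u, U u & E v u].

Definition nbhd (U : set V) (n : nat) : set V := iter n nbhd1 U.

Definition growth_rate (v : V) (r : nat) : \bar R :=
  (lne (counting (nbhd [set v] r)) / (ln r%:R)%:E)%E.

Definition lower_dim_at (v : V) : \bar R := limn_einf (growth_rate v).
Definition upper_dim_at (v : V) : \bar R := limn_esup (growth_rate v).

Definition lower_net_dim : \bar R := ereal_inf (range lower_dim_at).
Definition upper_net_dim : \bar R := ereal_sup (range upper_dim_at).

Definition dim_homogeneous := lower_net_dim = upper_net_dim.

(* The common value; meaningful only under [dim_homogeneous]. *)
Definition net_dim : \bar R := lower_net_dim.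

End ConnectivityDimension.

(* A metric space is a subset X of a type T with a function d on T x T, of
   which only the values on X x X matter. *)
Section MetricSpaces.
Variables (R : realType) (T : choiceType) (X : set T) (d : T -> T -> R).

Definition metric_on :=
  [/\ forall x y, X x -> X y -> 0 <= d x y,
      forall x y, X x -> X y -> d x y = 0 <-> x = y,
      forall x y, X x -> X y -> d x y = d y x
    & forall x y z, X x -> X y -> X z -> d x z <= d x y + d y z].

Definition metric_open (U : set T) :=
  U `<=` X /\
  forall x, U x -> exists2 r : R, 0 < r & forall y, X y -> d x y < r -> U y.

Definition eps_cover (eps : R) (F : set (set T)) :=
  [/\ forall U, F U -> metric_open U,
      forall U, F U -> forall x y, U x -> U y -> d x y <= eps
    & X `<=` \bigcup_(U in F) U].

Definition cover_number (eps : R) : \bar R :=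
  ereal_inf [set counting F | F in eps_cover eps].

Definition entropy_rate (eps : R) : \bar R :=
  (lne (lne (cover_number eps)) / (ln (- ln eps))%:E)%E.

Definition lower_metric_dim : \bar R := limf_einf entropy_rate 0^'+.
Definition upper_metric_dim : \bar R := limf_esup entropy_rate 0^'+.

Definition metric_dim_exists := lower_metric_dim = upper_metric_dim.

(* The common value; meaningful only under [metric_dim_exists]. *)
Definition metric_dim : \bar R := lower_metric_dim.

End MetricSpaces.

Definition compatible_metric (R : realType) (T : topologicalType) (X : set T)
    (d : T -> T -> R) :=
  metric_on X d /\
  forall U : set T,
    metric_open X d U <-> exists2 O : set T, open O & U = X `&` O.

Section MetricsOnSystems.
Variables (R : realType) (A : finType) (V : choiceType).
Variables (X : set (config V A)) (Phi : config V A -> config V A).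
Variable d : config V A -> config V A -> R.

Definition lipschitz_metric :=
  compatible_metric X d /\
  exists2 lambda : R, 0 < lambda &
    forall x x', X x -> X x' -> d (Phi x) (Phi x') <= lambda * d x x'.

Definition dim_compatible :=
  [/\ dim_homogeneous R (network Phi), metric_dim_exists X d
    & metric_dim X d = net_dim R (network Phi)].

End MetricsOnSystems.

Definition hoelder_on (R : realType) (T T' : Type) (X : set T)
    (d : T -> T -> R) (d' : T' -> T' -> R) (G : T -> T') :=
  exists eta lambda : R, [/\ 0 < eta, 0 < lambda &
    forall x y, X x -> X y -> d' (G x) (G y) <= lambda * d x y `^ eta].

(* Maps between X1 and X2 are restrictions of total functions. *)
Section Morphisms.
Variables (T1 T2 : topologicalType).
Variables (X1 : set T1) (Phi1 : T1 -> T1) (X2 : set T2) (Phi2 : T2 -> T2).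

Definition intertwines (G : T1 -> T2) :=
  forall x, X1 x -> G (Phi1 x) = Phi2 (G x).

Definition factor_mapping (G : T1 -> T2) :=
  [/\ {within X1, continuous G}, G @` X1 = X2 & intertwines G].

Definition homeo_on (G : T1 -> T2) (G' : T2 -> T1) :=
  [/\ {within X1, continuous G}, {within X2, continuous G'},
      G @` X1 `<=` X2 /\ G' @` X2 `<=` X1,
      forall x, X1 x -> G' (G x) = x
    & forall y, X2 y -> G (G' y) = y].

(* G' is the inverse of G *)
Definition conjugacy (G : T1 -> T2) (G' : T2 -> T1) :=
  homeo_on G G' /\ intertwines G.

End Morphisms.

(* Main.v *)
(* Metric dimension does not increase under a Hoelder surjection [G] of exponent
   [eta]: images of the members of an [eps]-cover, slightly thickened, form a
   cover at scale [K * eps `^ eta], and this change of scale alters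
   [ln (- ln eps)] only by a bounded amount, hence by a factor tending to 1.
   Dimensional compatibility carries the comparison over to the networks. *)
Require Import Defs.
From HB Require Import structures.
From mathcomp Require Import all_boot all_order all_algebra.
From mathcomp Require Import all_classical all_reals all_analysis.
From mathcomp Require Import ring lra.
Set Implicit Arguments.
Unset Strict Implicit.
Unset Printing Implicit Defensive.
Import Order.TTheory GRing.Theory Num.Theory.
Import numFieldNormedType.Exports.
Local Open Scope classical_set_scope.
Local Open Scope ring_scope.


(** A lower limit is a supremum over [S] in [F] of infima, so one good point in each [S] suffices.
    With [limf_einf_lt], comparing lower limits becomes comparing values at single scales. *)
Lemma limf_einf_le (R : realType) (T : choiceType) (Y : filteredType T)
    (f : Y -> \bar R) (F : set (set Y)) (x : \bar R) :
  (forall S, F S -> exists2 v, S v & (f v <= x)%E) ->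
  (limf_einf f F <= x)%E.
Proof.
move=> H; rewrite /limf_einf leeNl; apply: le_ereal_inf_tmp => _ [S FS <-].
have [v Sv fv] := H S FS.
apply: (@le_trans _ _ (- f v)%E); first by rewrite leeN2.
by apply: ereal_sup_ubound; exists v.
Qed.

Lemma limf_einf_lt (R : realType) (T : choiceType) (Y : filteredType T)
    (f : Y -> \bar R) (F : set (set Y)) (x : \bar R) :
  (limf_einf f F < x)%E -> forall S, F S -> exists2 v, S v & (f v < x)%E.
Proof.
rewrite /limf_einf lteNl => xlt S FS.
have : (- x < ereal_sup [set - f v | v in S])%E.
  by apply: (lt_le_trans xlt); apply: ereal_inf_lbound; exists S.
by move=> /ereal_sup_gt[_ [v Sv <-]]; rewrite lteN2 => ?; exists v.
Qed.

(** Two real gaps are left: [y < c'] yields a scale with rate below [c'], and [c' < c] absorbs the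
    distortion of the logarithms. *)
Lemma lee_real_separation (R : realType) (x y : \bar R) :
  (forall c' c : R, (y < c'%:E)%E -> c' < c -> (x <= c%:E)%E) -> (x <= y)%E.
Proof.
case: y => [r| |] H; last 2 first.
- by rewrite leey.
- case: x H => [s| |] // H.
  + have := H (s - 2) (s - 1) (ltNyr _); rewrite lee_fin => H1.
    have : s <= s - 1 by apply: H1; lra.
    by rewrite lerBrDr gerDl ler10.
  + by have := H 0 1 (ltNyr _) ltr01; rewrite leye_eq.
apply/lee_addgt0Pr => e e0; rewrite -EFinD; apply: (H (r + e / 2)); last lra.
by rewrite lte_fin; lra.
Qed.

(** No sign condition, since the outer logarithm of an entropy rate meets a nonpositive argument
    when the cover number is at most 1. *)
Lemma lee_lne (R : realType) (x y : \bar R) :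
  (x <= y)%E -> (lne x <= lne y)%E.
Proof.
have [x0 _|x0 xy] := leP x 0%E; first by rewrite le0_lneNy// leNye.
by rewrite exp.lee_lne// in_itv/= ?leey ?(ltW x0) // (le_trans (ltW x0)).
Qed.

Lemma counting_image_le (R : realType) (T U : choiceType) (f : T -> U)
    (F : set T) :
  (counting (f @` F) <= counting F :> \bar R)%E.
Proof.
rewrite {2}/counting; case: asboolP => [finF|_]; last by rewrite leey.
rewrite /counting asboolT; last exact: finite_image.
by rewrite lee_fin ler_nat fset_set_image// finmap.leq_imfset_card.
Qed.

(* The images of the members of a cover need not be open; thickening them by
   [delta] makes them so and at most triples the diameter. *)
Lemma cover_number_image_le (R : realType) (T1 T2 : choiceType)
    (X1 : set T1) (d1 : T1 -> T1 -> R) (X2 : set T2) (d2 : T2 -> T2 -> R)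
    (G : T1 -> T2) (eps delta : R) :
  metric_on X2 d2 -> G @` X1 = X2 -> 0 < delta ->
  (forall x y, X1 x -> X1 y -> d1 x y <= eps -> d2 (G x) (G y) <= delta) ->
  (cover_number X2 d2 (3 * delta) <= cover_number X1 d1 eps)%E.
Proof.
move=> [d2_ge0 d2_eq0 d2C d2_tri] GX1 delta0 HG.
have GX x : X1 x -> X2 (G x) by move=> Xx; rewrite -GX1; exists x.
apply: le_ereal_inf_tmp => _ [F [Fopen Fdiam Fcov] <-].
pose thick U := [set y | X2 y /\ exists2 x, U x & d2 (G x) y < delta].
apply: le_trans (counting_image_le R thick F).
apply: ereal_inf_lbound; exists (thick @` F) => //; split.
- move=> _ [U FU <-]; split=> [y []//|y [Xy [x Ux dxy]]].
  have Xx : X1 x by have [+ _] := Fopen _ FU; apply.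
  exists (delta - d2 (G x) y) => [|z Xz yz]; first by rewrite subr_gt0.
  split=> //; exists x => //.
  by have := d2_tri _ _ _ (GX _ Xx) Xy Xz; lra.
- move=> _ [U FU <-] y z [Xy [x Ux xy]] [Xz [x' Ux' x'z]].
  have UX : U `<=` X1 by have [] := Fopen _ FU.
  (* The path [y], [G x], [G x'], [z] has three legs of length at most [delta]. *)
  have GxX := GX _ (UX _ Ux); have Gx'X := GX _ (UX _ Ux').
  have := HG _ _ (UX _ Ux) (UX _ Ux') (Fdiam _ FU _ _ Ux Ux').
  have := d2_tri _ _ _ Xy GxX Xz; have := d2_tri _ _ _ GxX Gx'X Xz.
  rewrite (d2C _ _ Xy GxX); lra.
- rewrite -GX1 => _ [x Xx <-]; have [U FU Ux] := Fcov _ Xx.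
  exists (thick U); first by exists U.
  split; first exact: GX.
  by exists x => //; rewrite (iffRL (d2_eq0 _ _ _ _))//; exact: GX.
Qed.

(** [ln (eta * t - k)] differs from [ln t] by a bounded amount, which the gap [(c - c') * ln t]
    eventually dominates. It is applied to [t = - ln e]. *)
Lemma near_pinfty_ln_affine (R : realType) (eta k c' c : R) :
  0 < eta -> c' < c ->
  \forall t \near +oo,
    [/\ 0 < ln t, 0 < ln (eta * t - k) & c' * ln t <= c * ln (eta * t - k)].
Proof.
move=> eta0 c'c.
pose m := `|ln (eta / 2)| + `|ln (2 * eta)|.
near=> t.
have t1 : 1 < t by near: t; apply: nbhs_pinfty_gt; exact: num_real.
have t0 : 0 < t by lra.
have lnt0 : 0 < ln t by exact: ln_gt0.
(* The thresholds give, in turn, a positive logarithm, the sandwich of [eta * t - k] between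
   [eta / 2 * t] and [2 * eta * t], and the domination of [|c| * m]. *)
have kt1 : (1 + k) / eta < t by near: t; apply: nbhs_pinfty_gt; exact: num_real.
have kt2 : 2 * `|k| / eta < t by near: t; apply: nbhs_pinfty_gt; exact: num_real.
have mt : expR (`|c| * m / (c - c')) < t by near: t; apply: nbhs_pinfty_gt; exact: num_real.
move: kt1 kt2; rewrite !ltr_pdivrMr// => kt1 kt2.
have kN : - `|k| <= k by rewrite lerNl ler_normr lexx orbT.
have kP : k <= `|k| by exact: ler_norm.
have {}kt1 : 1 < eta * t - k by lra.
have {}mt : `|c| * m <= (c - c') * ln t.
  by rewrite [leRHS]mulrC -ler_pdivrMr ?subr_gt0// -ler_expR lnK ?posrE// ltW.
have lo : ln (eta / 2) + ln t <= ln (eta * t - k).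
  by rewrite -lnM ?posrE ?divr_gt0// ler_ln ?posrE ?mulr_gt0 ?divr_gt0//; lra.
have hi : ln (eta * t - k) <= ln (2 * eta) + ln t.
  by rewrite -lnM ?posrE ?mulr_gt0// ler_ln ?posrE ?mulr_gt0//; lra.
split=> //; first exact: ln_gt0.
have um : `|ln (eta * t - k) - ln t| <= m.
  rewrite ler_norml /m.
  have := ler_norm (ln (2 * eta)); have := ler_norm (- ln (eta / 2)).
  rewrite normrN => h1 h2.
  have := normr_ge0 (ln (2 * eta)); have := normr_ge0 (ln (eta / 2)).
  lra.
(* The sign of [c] is arbitrary, hence the absolute value. *)
have : - (`|c| * m) <= c * (ln (eta * t - k) - ln t).
  rewrite lerNl -mulrN (le_trans (ler_norm _))// normrM normrN.
  exact: ler_wpM2l.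
lra.
Unshelve. all: end_near. Qed.

Lemma lower_metric_dim_hoelder_le (R : realType) (T1 T2 : choiceType)
    (X1 : set T1) (d1 : T1 -> T1 -> R) (X2 : set T2) (d2 : T2 -> T2 -> R)
    (G : T1 -> T2) :
  metric_on X1 d1 -> metric_on X2 d2 -> G @` X1 = X2 ->
  hoelder_on X1 d1 d2 G ->
  (lower_metric_dim X2 d2 <= lower_metric_dim X1 d1)%E.
Proof.
move=> [d1_ge0 _ _ _] md2 GX1 [eta [lambda [eta0 lambda0 HG]]].
apply: lee_real_separation => c' c dim1 c'c.
(* The scale on [X2] matching [e] on [X1]: thickening by [delta = lambda * e ^ eta] costs the factor
   3. *)
pose phi (e : R) : R := 3 * (lambda * e `^ eta).
have phi_gt0 e : 0 < e -> 0 < phi e.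
  by move=> e0; rewrite !mulr_gt0// powR_gt0.
have lnphi e : 0 < e -> - ln (phi e) = eta * - ln e - ln (3 * lambda).
  move=> e0; rewrite /phi mulrA lnM ?posrE ?mulr_gt0 ?powR_gt0//.
  by rewrite ln_powR; ring.
have Nln_cvg : - ln e @[e --> (0 : R)^'+] --> +oo.
  by apply/cvgNry; exact: lnNy.
apply: limf_einf_le => S; rewrite /= /at_right /within/= => -[r /= r0 rS].
have near_eps : \forall e \near 0^'+, [/\ 0 < e, phi e < r,
    0 < ln (- ln e), 0 < ln (- ln (phi e))
  & c' * ln (- ln e) <= c * ln (- ln (phi e))].
  near=> e.
  have e0 : 0 < e by near: e; exact: nbhs_right_gt.
  rewrite lnphi//.
  have [? ? ?] : [/\ 0 < ln (- ln e), 0 < ln (eta * - ln e - ln (3 * lambda))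
      & c' * ln (- ln e) <= c * ln (eta * - ln e - ln (3 * lambda))].
    near: e.
    exact: (Nln_cvg _ (near_pinfty_ln_affine (ln (3 * lambda)) eta0 c'c)).
  split=> //.
  (* After taking logarithms, [phi e < r] only asks that [- ln e] be large. *)
  rewrite -ltr_ln ?posrE ?phi_gt0// -ltrN2 lnphi// ltrBrDr -ltr_pdivrMl//.
  near: e; exact: (Nln_cvg _ (nbhs_pinfty_gt (num_real _))).
(* The scale conditions hold for all small [e], the rate bound for arbitrarily small ones; some [e]
   meets both. *)
have [e [e0 er lnt lnphit cc] Ee] := limf_einf_lt dim1 near_eps.
exists (phi e).
  by apply: rS; rewrite ?phi_gt0//= sub0r normrN gtr0_norm ?phi_gt0.
(* Positive denominators exclude the special value of the inverse at 0 and can be cleared. *)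
rewrite /entropy_rate inver gt_eqF// lee_pdivrMr//.
move: Ee; rewrite /entropy_rate inver gt_eqF// lte_pdivrMr// => /ltW Ee.
have cov : (cover_number X2 d2 (phi e) <= cover_number X1 d1 e)%E.
  apply: (cover_number_image_le md2 GX1) => [|x y Xx Xy xy].
    by rewrite mulr_gt0// powR_gt0.
  apply: (le_trans (HG _ _ Xx Xy)); rewrite ler_pM2l//.
  by apply: ge0_ler_powR; rewrite ?nnegrE ?(ltW eta0) ?(ltW e0)// d1_ge0.
apply: (le_trans (lee_lne (lee_lne cov))); apply: (le_trans Ee).
by rewrite -!EFinM lee_fin.
Unshelve. all: end_near. Qed.

Theorem corollary5p8 (R : realType) (A B : finType) (V W : choiceType)
    (cardV : ([set: V] #= [set: nat])%card)
    (cardW : ([set: W] #= [set: nat])%card)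
    (X1 : set (config V A)) (Phi1 : config V A -> config V A)
    (X2 : set (config W B)) (Phi2 : config W B -> config W B)
    (sys1 : symbolic_system X1 Phi1) (sys2 : symbolic_system X2 Phi2)
    (d1 : config V A -> config V A -> R) (d2 : config W B -> config W B -> R)
    (lip1 : lipschitz_metric X1 Phi1 d1) (lip2 : lipschitz_metric X2 Phi2 d2)
    (dim1 : dim_compatible X1 Phi1 d1) (dim2 : dim_compatible X2 Phi2 d2) :
  ((exists G : config V A -> config W B,
      factor_mapping X1 Phi1 X2 Phi2 G /\ hoelder_on X1 d1 d2 G) ->
   (net_dim R (network Phi1) >= net_dim R (network Phi2))%E) /\
  ((exists (G : config V A -> config W B) (G' : config W B -> config V A),
      [/\ conjugacy X1 Phi1 X2 Phi2 G G', hoelder_on X1 d1 d2 G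
        & hoelder_on X2 d2 d1 G']) ->
   net_dim R (network Phi1) = net_dim R (network Phi2)).
Proof.
(* Both network dimensions are replaced by metric dimensions, which are lower ones by definition. *)
case: lip1 lip2 dim1 dim2 => -[m1 _] _ [[m2 _] _] [_ _ <-] [_ _ <-].
split=> [[G [[_ GX _] hG]]|[G [G' [[[_ _ [GX GX'] GK GK'] _] hG hG']]]].
  exact: lower_metric_dim_hoelder_le m1 m2 GX hG.
(* Mutually inverse maps are both surjective, so the inequality applies in each direction. *)
have GE : G @` X1 = X2.
  apply/seteqP; split=> // y Xy; exists (G' y); last exact: GK'.
  by apply: GX'; exists y.
have GE' : G' @` X2 = X1.
  apply/seteqP; split=> // x Xx; exists (G x); last exact: GK.
  by apply: GX; exists x.
by apply/eqP; rewrite eq_le (lower_metric_dim_hoelder_le m2 m1 GE' hG')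
  (lower_metric_dim_hoelder_le m1 m2 GE hG).
Qed.
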